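(* Let $\mathcal C$ be a semi-$\mathcal Z$-prenormal category such that $\mathcal Z$ is also a reflective subcategory of $\mathcal C$. For each object $X$ let $\epsilon_X\colon \zeta X\to X$ denote a $\mathcal Z$-coreflection of $X$. There is a bijective correspondence between $\mathcal Z$-normal-epi-reflective (full, replete) subcategories of $\mathcal C$ and $\mathcal Z$-normal closure operators on $\mathcal C$ (up to isomorphism of closure operators). This correspondence specialises to a bijective correspondence between $\mathcal Z$-torsion-free subcategories of $\mathcal C$ and weakly hereditary $\mathcal Z$-normal closure operators on $\mathcal C$ (up to isomorphism), in such a way that the $\mathcal Z$-torsion theory $(\mathcal T,\mathcal F)$ corresponding to a closure operator $C$ is given by $$\mathcal T=\{X\in\mathcal C\mid \epsilon_X\colon\zeta X\to X\text{ is }C\text{-dense}\},\qquad \mathcal F=\{X\in\mathcal C\mid \epsilon_X\colon\zeta X\to X\text{ is }C\text{-closed}\}.$$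
   Context: Let $\mathcal C$ be a category and $\mathcal Z$ a full replete subcategory (the trivial objects). A morphism of $\mathcal C$ is $\mathcal Z$-trivial if it factors through an object of $\mathcal Z$. A $\mathcal Z$-kernel of $f\colon A\to B$ is a pair $(K,k\colon K\to A)$ such that $f\circ k$ is $\mathcal Z$-trivial and every $x\colon X\to A$ with $f\circ x$ $\mathcal Z$-trivial factors uniquely as $x=k\circ x'$. A $\mathcal Z$-cokernel is defined dually. A $\mathcal Z$-normal monomorphism (resp. $\mathcal Z$-normal epimorphism) is a morphism that is a $\mathcal Z$-kernel (resp. $\mathcal Z$-cokernel) of some morphism. A sequence $A\xrightarrow{f}B\xrightarrow{g}C$ is $\mathcal Z$-exact if $(A,f)$ is the $\mathcal Z$-kernel of $g$ and $(C,g)$ is the $\mathcal Z$-cokernel of $f$. $\mathcal C$ is semi-$\mathcal Z$-prenormal if $\mathcal Z$ is mono-coreflective in $\mathcal C$ (the inclusion has a right adjoint and the counit components are monomorphisms) and: (1) $\mathcal C$ has pullbacks along $\mathcal Z$-normal monomorphisms; (2) $\mathcal C$ has $\mathcal Z$-cokernels of $\mathcal Z$-kernels; (3) the pullback of a $\mathcal Z$-normal epimorphism along a $\mathcal Z$-normal monomorphism is a $\mathcal Z$-normal epimorphism. A $\mathcal Z$-torsion theory on $\mathcal C$ is a pair $(\mathcal T,\mathcal F)$ of full replete subcategories such that every morphism $A\to B$ with $A\in\mathcal T$, $B\in\mathcal F$ is $\mathcal Z$-trivial, and for every object $X$ there is a $\mathcal Z$-exact sequence $A\to X\to B$ with $A\in\mathcal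 T$ and $B\in\mathcal F$. $\mathcal F$ is $\mathcal Z$-torsion-free if such a $\mathcal T$ exists. A full replete subcategory is $\mathcal Z$-normal-epi-reflective if its inclusion in $\mathcal C$ has a left adjoint and the unit components are $\mathcal Z$-normal epimorphisms. Closure operators. Let $\mathcal M$ be the class of $\mathcal Z$-normal monomorphisms of $\mathcal C$ and $\mathcal M(X)$ the class of those with codomain $X$ (when $\mathcal Z$ is reflective, identities belong to $\mathcal M$). For monomorphisms $m,n$ with the same codomain, write $m\le n$ if $m=n\circ j$ for some (unique) $j$, and $m\cong n$ if $m\le n$ and $n\le m$. For $f\colon Y\to X$ and $a\in\mathcal M(X)$, $f^{-1}(a)\in\mathcal M(Y)$ denotes the pullback of $a$ along $f$. A closure operator $C$ on $\mathcal M$ is a family of functions $c_X\colon\mathcal M(X)\to\mathcal M(X)$, one for each object $X$, such that for all $a,b\in\mathcal M(X)$ and $f\colon Y\to X$: $a\le c_X(a)$; $a\le b$ implies $c_X(a)\le c_X(b)$; $c_Y(f^{-1}(a))\le f^{-1}(c_X(a))$. An element $a\in\mathcal M(X)$ is $C$-closed if $c_X(a)\cong a$, and $C$-dense if $c_X(a)\cong \mathrm{id}_X$. $C$ is idempotent if $c_X(c_X(a))\cong c_X(a)$ for all $a$. An idempotent closure operator is weakly hereditary if for all $a\colon A\to X$ in $\mathcal M(X)$, with $c_X(a)\colon B\to X$ and $j\colon A\to B$ the unique morphism with $c_X(a)\circ j=a$, one has $c_B(j)\cong\mathrm{id}_B$. A $\mathcal Z$-normal closure operator on $\mathcal C$ is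 an idempotent closure operator on $\mathcal M$ such that $c_Y(f^{-1}(a))\cong f^{-1}(c_X(a))$ for all $a\in\mathcal M(X)$ and all $\mathcal Z$-normal epimorphisms $f\colon Y\to X$. Two closure operators $C,C'$ are isomorphic if $c_X(a)\cong c'_X(a)$ for all $X$ and $a\in\mathcal M(X)$; closure operators are identified up to isomorphism. *)

(* Defs.v *)
Set Implicit Arguments.
Unset Strict Implicit.
Unset Printing Implicit Defensive.

Declare Scope cat_scope.
Delimit Scope cat_scope with cat.
Local Open Scope cat_scope.

Record category := Category {
  ob :> Type;
  hom : ob -> ob -> Type;
  idm : forall X : ob, hom X X;
  comp : forall X Y W : ob, hom Y W -> hom X Y -> hom X W;
  comp_idl : forall (X Y : ob) (f : hom X Y), comp (idm Y) f = f;
  comp_idr : forall (X Y : ob) (f : hom X Y), comp f (idm X) = f;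
  comp_assoc : forall (X Y V W : ob) (h : hom V W) (g : hom Y V) (f : hom X Y),
    comp h (comp g f) = comp (comp h g) f
}.

Arguments hom {c} X Y.
Arguments idm {c} X.
Arguments comp {c X Y W} g f.

Notation "X ~> Y" := (hom X Y) (at level 90, right associativity) : cat_scope.
Notation "g ∘ f" := (comp g f) (at level 40, left associativity) : cat_scope.

Record functor (C D : category) := Functor {
  fobj :> C -> D;
  fmap : forall X Y : C, (X ~> Y) -> (fobj X ~> fobj Y);
  fmap_id : forall X : C, fmap (idm X) = idm (fobj X);
  fmap_comp : forall (X Y W : C) (g : Y ~> W) (f : X ~> Y),
    fmap (g ∘ f) = fmap g ∘ fmap f
}.

Record adjunction (C D : category) (L : functor C D) (R : functor D C) :=
  Adjunction {
  unit_adj : forall X : C, X ~> R (L X);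
  counit_adj : forall A : D, L (R A) ~> A;
  unit_natural : forall (X Y : C) (f : X ~> Y),
    fmap R (fmap L f) ∘ unit_adj X = unit_adj Y ∘ f;
  counit_natural : forall (A B : D) (f : A ~> B),
    f ∘ counit_adj A = counit_adj B ∘ fmap L (fmap R f);
  triangle_left : forall X : C,
    counit_adj (L X) ∘ fmap L (unit_adj X) = idm (L X);
  triangle_right : forall A : D,
    fmap R (counit_adj A) ∘ unit_adj (R A) = idm (R A)
}.

Definition is_mono (C : category) (X Y : C) (m : X ~> Y) : Prop :=
  forall (W : C) (u v : W ~> X), m ∘ u = m ∘ v -> u = v.

Definition isomorphic (C : category) (X Y : C) : Prop :=
  exists (f : X ~> Y) (g : Y ~> X), g ∘ f = idm X /\ f ∘ g = idm Y.

(* The commutative square   P --p1--> X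
                            |p2       |f
                            Y --g---> W   is a pullback. *)
Definition is_pullback (C : category) (P X Y W : C)
    (p1 : P ~> X) (p2 : P ~> Y) (f : X ~> W) (g : Y ~> W) : Prop :=
  f ∘ p1 = g ∘ p2 /\
  forall (V : C) (u : V ~> X) (v : V ~> Y), f ∘ u = g ∘ v ->
    exists! w : V ~> P, p1 ∘ w = u /\ p2 ∘ w = v.

(* Full replete subcategories, given by their classes of objects. *)
Record subcategory (C : category) := Subcategory {
  mem_sub :> C -> Prop;
  replete_sub : forall X Y : C, isomorphic X Y -> mem_sub X -> mem_sub Y
}.

Definition sub_eq (C : category) (S S' : subcategory C) : Prop :=
  forall X : C, S X <-> S' X.

Definition full (C : category) (S : subcategory C) : category :=
  @Category {X : C | S X}
    (fun X Y => proj1_sig X ~> proj1_sig Y)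
    (fun X => idm (proj1_sig X))
    (fun X Y W g f => g ∘ f)
    (fun X Y f => comp_idl f)
    (fun X Y f => comp_idr f)
    (fun X Y V W h g f => comp_assoc h g f).

Definition incl (C : category) (S : subcategory C) : functor (full S) C :=
  @Functor (full S) C
    (fun X => proj1_sig X)
    (fun X Y f => f)
    (fun X => eq_refl)
    (fun X Y W g f => eq_refl).

Definition reflective (C : category) (S : subcategory C) : Prop :=
  exists L : functor C (full S), inhabited (adjunction L (incl S)).

Record mono_coreflector (C : category) (S : subcategory C) := MonoCoreflector {
  corefl : functor C (full S);
  corefl_adj : adjunction (incl S) corefl;
  corefl_mono : forall X : C, is_mono (counit_adj corefl_adj X)
}.

Definition mono_coreflective (C : category) (S : subcategory C) : Prop :=
  inhabited (mono_coreflector S).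

Definition eps (C : category) (S : subcategory C) (E : mono_coreflector S)
    (X : C) : incl S (corefl E X) ~> X :=
  counit_adj (corefl_adj E) X.

Definition trivial (C : category) (Z : subcategory C) (X Y : C)
    (f : X ~> Y) : Prop :=
  exists (W : C) (u : X ~> W) (v : W ~> Y), Z W /\ f = v ∘ u.

Definition is_kernel (C : category) (Z : subcategory C) (K A B : C)
    (f : A ~> B) (k : K ~> A) : Prop :=
  trivial Z (f ∘ k) /\
  forall (X : C) (x : X ~> A), trivial Z (f ∘ x) ->
    exists! x' : X ~> K, x = k ∘ x'.

Definition is_cokernel (C : category) (Z : subcategory C) (A B Q : C)
    (f : A ~> B) (q : B ~> Q) : Prop :=
  trivial Z (q ∘ f) /\
  forall (Y : C) (y : B ~> Y), trivial Z (y ∘ f) ->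
    exists! y' : Q ~> Y, y = y' ∘ q.

Definition normal_mono (C : category) (Z : subcategory C) (K A : C)
    (k : K ~> A) : Prop :=
  exists (B : C) (f : A ~> B), is_kernel Z f k.

Definition normal_epi (C : category) (Z : subcategory C) (B Q : C)
    (q : B ~> Q) : Prop :=
  exists (A : C) (f : A ~> B), is_cokernel Z f q.

Definition exact (C : category) (Z : subcategory C) (A B D : C)
    (f : A ~> B) (g : B ~> D) : Prop :=
  is_kernel Z g f /\ is_cokernel Z f g.

Record semi_prenormal (C : category) (Z : subcategory C) : Prop :=
  SemiPrenormal {
  spn_coreflective : mono_coreflective Z;
  spn_pullback : forall (X Y W : C) (f : X ~> W) (m : Y ~> W),
    normal_mono Z m ->
    exists (P : C) (p1 : P ~> X) (p2 : P ~> Y), is_pullback p1 p2 f m;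
  spn_cokernel : forall (K A : C) (k : K ~> A), normal_mono Z k ->
    exists (Q : C) (q : A ~> Q), is_cokernel Z k q;
  spn_stable : forall (P X Y W : C) (p1 : P ~> X) (p2 : P ~> Y)
      (m : X ~> W) (e : Y ~> W),
    normal_mono Z m -> normal_epi Z e -> is_pullback p1 p2 m e ->
    normal_epi Z p1
}.

Definition is_torsion_theory (C : category) (Z T F : subcategory C) : Prop :=
  (forall (A B : C) (f : A ~> B), T A -> F B -> trivial Z f) /\
  (forall X : C, exists (A B : C) (f : A ~> X) (g : X ~> B),
    T A /\ F B /\ exact Z f g).

Definition torsion_free (C : category) (Z F : subcategory C) : Prop :=
  exists T : subcategory C, is_torsion_theory Z T F.

Definition normal_epi_reflective (C : category) (Z S : subcategory C) : Prop :=
  exists (L : functor C (full S)) (adj : adjunction L (incl S)),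
    forall X : C, normal_epi Z (unit_adj adj X : X ~> incl S (L X)).

Definition mor_le (C : category) (A B X : C) (m : A ~> X) (n : B ~> X) : Prop :=
  exists j : A ~> B, m = n ∘ j.

Definition mor_equiv (C : category) (A B X : C) (m : A ~> X) (n : B ~> X) :
    Prop :=
  mor_le m n /\ mor_le n m.

(* The class M(X). *)
Record nsub (C : category) (Z : subcategory C) (X : C) := NSub {
  nsub_dom : C;
  nsub_mor : nsub_dom ~> X;
  nsub_normal : normal_mono Z nsub_mor
}.

(* b is f^{-1}(a). Pullbacks are determined up to isomorphism only, hence a
   relation; nsub_inv_exists gives existence. *)
Definition is_nsub_inv (C : category) (Z : subcategory C) (X Y : C)
    (f : Y ~> X) (a : nsub Z X) (b : nsub Z Y) : Prop :=
  exists p : nsub_dom b ~> nsub_dom a,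
    is_pullback (nsub_mor b) p f (nsub_mor a).

Record closure_operator (C : category) (Z : subcategory C) :=
  ClosureOperator {
  cl :> forall X : C, nsub Z X -> nsub Z X;
  cl_ext : forall (X : C) (a : nsub Z X), mor_le (nsub_mor a) (nsub_mor (cl a));
  cl_mono : forall (X : C) (a b : nsub Z X),
    mor_le (nsub_mor a) (nsub_mor b) ->
    mor_le (nsub_mor (cl a)) (nsub_mor (cl b));
  cl_cont : forall (X Y : C) (f : Y ~> X) (a : nsub Z X) (b d : nsub Z Y),
    is_nsub_inv f a b -> is_nsub_inv f (cl a) d ->
    mor_le (nsub_mor (cl b)) (nsub_mor d)
}.

Arguments cl {C Z} c {X} a.

Definition cl_iso (C : category) (Z : subcategory C)
    (c c' : closure_operator Z) : Prop :=
  forall (X : C) (a : nsub Z X),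
    mor_equiv (nsub_mor (cl c a)) (nsub_mor (cl c' a)).

Definition cl_closed (C : category) (Z : subcategory C)
    (c : closure_operator Z) (X : C) (a : nsub Z X) : Prop :=
  mor_equiv (nsub_mor (cl c a)) (nsub_mor a).

Definition cl_dense (C : category) (Z : subcategory C)
    (c : closure_operator Z) (X : C) (a : nsub Z X) : Prop :=
  mor_equiv (nsub_mor (cl c a)) (idm X).

Definition idempotent (C : category) (Z : subcategory C)
    (c : closure_operator Z) : Prop :=
  forall (X : C) (a : nsub Z X),
    mor_equiv (nsub_mor (cl c (cl c a))) (nsub_mor (cl c a)).

Definition normal_closure_operator (C : category) (Z : subcategory C)
    (c : closure_operator Z) : Prop :=
  idempotent c /\
  forall (X Y : C) (f : Y ~> X) (a : nsub Z X) (b d : nsub Z Y),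
    normal_epi Z f -> is_nsub_inv f a b -> is_nsub_inv f (cl c a) d ->
    mor_equiv (nsub_mor (cl c b)) (nsub_mor d).

Lemma trivial_comp (C : category) (Z : subcategory C) (X Y W : C)
    (g : Y ~> W) (f : X ~> Y) : trivial Z g -> trivial Z (g ∘ f).
Proof.
intros [V [u [v [ZV ->]]]]; exists V, (u ∘ f), v; split; [exact ZV|].
now rewrite comp_assoc.
Qed.

Lemma kernel_mono (C : category) (Z : subcategory C) (K A B : C)
    (f : A ~> B) (k : K ~> A) : is_kernel Z f k -> is_mono k.
Proof.
intros [tk uk] W u v e.
destruct (uk _ (k ∘ u)) as [w [_ Hw]].
{ rewrite comp_assoc; now apply trivial_comp. }
now rewrite <- (Hw u eq_refl); apply Hw.
Qed.

Lemma nsub_mono (C : category) (Z : subcategory C) (X : C) (a : nsub Z X) :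
  is_mono (nsub_mor a).
Proof. destruct (nsub_normal a) as [B [f kf]]; exact (kernel_mono kf). Qed.

Lemma normal_mono_pullback (C : category) (Z : subcategory C) (P X Y W : C)
    (p1 : P ~> X) (p2 : P ~> Y) (f : X ~> W) (m : Y ~> W) :
  normal_mono Z m -> is_pullback p1 p2 f m -> normal_mono Z p1.
Proof.
intros [B [g [tg ug]]] [sq univ]; exists B, (g ∘ f); split.
{ rewrite <- comp_assoc, sq, comp_assoc; now apply trivial_comp. }
intros V x; rewrite <- comp_assoc; intros tx.
destruct (ug _ _ tx) as [y [ey uy]].
destruct (univ _ x y ey) as [w [[e1 e2] uw]].
exists w; split; [now symmetry|].
intros w' ew'; apply uw; split; [now symmetry|].
symmetry; apply uy; now rewrite comp_assoc, <- sq, <- comp_assoc, <- ew'.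
Qed.

Lemma nsub_inv_exists (C : category) (Z : subcategory C) (X Y : C)
    (f : Y ~> X) (a : nsub Z X) :
  semi_prenormal Z -> exists b : nsub Z Y, is_nsub_inv f a b.
Proof.
intros hC.
destruct (spn_pullback hC f (nsub_normal a)) as [P [p1 [p2 pb]]].
exists (NSub (normal_mono_pullback (nsub_normal a) pb)); now exists p2.
Qed.

Lemma normal_mono_cancel (C : category) (Z : subcategory C) (A B X : C)
    (b : B ~> X) (j : A ~> B) :
  is_mono b -> normal_mono Z (b ∘ j) -> normal_mono Z j.
Proof.
intros mb [D [g [tg ug]]]; exists D, (g ∘ b); split.
{ now rewrite <- comp_assoc. }
intros V x; rewrite <- comp_assoc; intros tx.
destruct (ug _ _ tx) as [y [ey uy]].
exists y; split; [now apply mb; rewrite comp_assoc|].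
now intros y' ->; apply uy; rewrite comp_assoc.
Qed.

Lemma nsub_factor_normal (C : category) (Z : subcategory C) (X : C)
    (a b : nsub Z X) (j : nsub_dom a ~> nsub_dom b) :
  nsub_mor b ∘ j = nsub_mor a -> normal_mono Z j.
Proof.
intros e; apply (normal_mono_cancel (nsub_mono (a := b))).
rewrite e; exact (nsub_normal a).
Qed.

Definition weakly_hereditary (C : category) (Z : subcategory C)
    (c : closure_operator Z) : Prop :=
  forall (X : C) (a : nsub Z X) (j : nsub_dom a ~> nsub_dom (cl c a))
    (e : nsub_mor (cl c a) ∘ j = nsub_mor a),
  cl_dense c (NSub (nsub_factor_normal e)).

Lemma eps_normal (C : category) (Z : subcategory C) (E : mono_coreflector Z)
    (X : C) : normal_mono Z (eps E X).
Proof.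
exists X, (idm X); split.
{ exists (incl Z (corefl E X)), (idm _), (eps E X); split.
  - exact (proj2_sig (corefl E X)).
  - now rewrite comp_idl, comp_idr. }
intros V x; rewrite comp_idl; intros [W [u [v [ZW ->]]]].
pose (W' := exist _ W ZW : full Z).
pose (A := corefl_adj E).
exists (fmap (incl Z) (fmap (corefl E) v) ∘ (unit_adj A W' : W ~> _) ∘ u); split.
- rewrite !comp_assoc; f_equal.
  unfold eps; fold A; rewrite <- (counit_natural A v), <- comp_assoc.
  assert (t := triangle_left A W'); cbn in t |- *.
  now rewrite t, comp_idr.
- intros y ey; apply (corefl_mono (m := E) (X := X)); fold A.
  change (eps E X ∘ (fmap (incl Z) (fmap (corefl E) v) ∘ (unit_adj A W' : W ~> _) ∘ u)
          = eps E X ∘ y).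
  rewrite <- ey, !comp_assoc; f_equal.
  unfold eps; fold A; rewrite <- (counit_natural A v), <- comp_assoc.
  assert (t := triangle_left A W'); cbn in t |- *.
  now rewrite t, comp_idr.
Qed.

Definition eps_nsub (C : category) (Z : subcategory C)
    (E : mono_coreflector Z) (X : C) : nsub Z X :=
  NSub (eps_normal E X).

(* f induces a bijection from {a | PA a} modulo eqA to {b | PB b} modulo eqB. *)
Definition bijective_correspondence (A B : Type) (eqA : A -> A -> Prop)
    (eqB : B -> B -> Prop) (PA : A -> Prop) (PB : B -> Prop) (f : A -> B) :
    Prop :=
  (forall a, PA a -> PB (f a)) /\
  (forall a a', PA a -> PA a' -> (eqA a a' <-> eqB (f a) (f a'))) /\
  (forall b, PB b -> exists a, PA a /\ eqB (f a) b).

(* Main.v *)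
From Stdlib Require Import IndefiniteDescription.
Require Import Defs.

(** The whole correspondence rests on one formula.  A subcategory [F]
    determines on each [M(X)] the closure whose value at [a] contains exactly
    the arrows [x] such that every [f : X -> Y] with [Y] in [F] that
    trivialises [a] also trivialises [x] (an analogue of the regular closure
    of Salbany); [regular_closure c F] says that [c] is this closure.

    From reflectors to closures: if [F] is normal-epi-reflective, then among
    all the [f] above there is a universal one, namely the cokernel of [a]
    followed by the reflection of its codomain, and the kernel of this
    composite is the closure of [a] ([regular_closure_exists]).  The closure
    axioms and idempotence can then be read off the formula.  Invariance under
    the inverse image along a normal epimorphism [e] comes from
    [cokernel_inverse_image]: whatever trivialises the inverse image of [a]
    along [e] factors through [e] as an arrow trivialising [a]
    ([regular_closure_normal]).  Moreover [F] consists of the objects whose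
    coreflection is closed ([sub_eq_closed_objects]), because an object whose
    reflection has a trivial kernel is isomorphic to its reflection.

    From closures to reflectors: let [c] be normal and let [F] be the class of
    the objects whose coreflection is closed.  The cokernel of
    [c(eps_X)] is the reflection of [X] in [F] ([cokernel_closure_eps_closed],
    [cokernel_closure_eps_reflection]).  The element [a] is the inverse image
    of a coreflection along its own cokernel [q], so normality gives
    [c(a) = q^-1 (c (eps_Q))], and this is the formula above
    ([normal_closure_regular]).  As the formula determines [c] up to
    isomorphism, the correspondence is bijective.

    Torsion theories: by the formula, [eps_X] is dense iff every arrow from [X]
    to an object of [F] is trivial ([dense_eps_iff]), which identifies the
    torsion class.  Weak heredity makes the domain of [c(eps_X)] a torsion
    object, which yields the exact sequence of [X] ([closure_torsion_theory]).
    Conversely, in the presence of a torsion theory, [c(a)] is the inverse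
    image of the torsion part of [Q] along [q], so that its domain is mapped to
    a torsion object by a normal epimorphism whose kernel lies below [a]; this
    forces [a] to be dense in its closure ([torsion_free_weakly_hereditary]). *)

Set Implicit Arguments.
Unset Strict Implicit.
Unset Printing Implicit Defensive.

Local Open Scope cat_scope.

(** * Trivial morphisms, kernels and cokernels *)

Lemma trivial_postcomp (C : category) (Z : subcategory C) (X Y W : C)
    (g : Y ~> W) (f : X ~> Y) : trivial Z f -> trivial Z (g ∘ f).
Proof.
intros [V [u [v [ZV ->]]]]; exists V, u, (g ∘ v); split; [exact ZV|].
now rewrite comp_assoc.
Qed.

Lemma trivial_le (C : category) (Z : subcategory C) (A B X Y : C)
    (x : A ~> X) (k : B ~> X) (f : X ~> Y) :
  mor_le x k -> trivial Z (f ∘ k) -> trivial Z (f ∘ x).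
Proof. intros [j ->] t; rewrite comp_assoc; now apply trivial_comp. Qed.

Lemma trivial_eps (C : category) (Z : subcategory C) (E : mono_coreflector Z)
    (X : C) : trivial Z (eps E X).
Proof.
exists (incl Z (corefl E X)), (idm _), (eps E X); split.
- exact (proj2_sig (corefl E X)).
- now rewrite comp_idr.
Qed.

Lemma mor_le_refl (C : category) (A X : C) (m : A ~> X) : mor_le m m.
Proof. exists (idm A); now rewrite comp_idr. Qed.

Lemma mor_le_trans (C : category) (A B D X : C) (m : A ~> X) (n : B ~> X)
    (p : D ~> X) : mor_le m n -> mor_le n p -> mor_le m p.
Proof. intros [i ->] [j ->]; exists (j ∘ i); now rewrite comp_assoc. Qed.

Lemma mor_le_precomp (C : category) (A B D X : C) (m : A ~> X) (n : B ~> X)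
    (i : D ~> A) : mor_le m n -> mor_le (m ∘ i) n.
Proof. intros [j ->]; exists (j ∘ i); now rewrite comp_assoc. Qed.

Lemma kernel_le_iff (C : category) (Z : subcategory C) (K A B V : C)
    (f : A ~> B) (k : K ~> A) (x : V ~> A) :
  is_kernel Z f k -> (trivial Z (f ∘ x) <-> mor_le x k).
Proof.
intros [tk uk]; split.
- intros tx; destruct (uk _ x tx) as [y [ey _]]; now exists y.
- intros le; exact (trivial_le le tk).
Qed.

Lemma trivial_le_normal_mono (C : category) (Z : subcategory C) (V K X : C)
    (x : V ~> X) (k : K ~> X) : normal_mono Z k -> trivial Z x -> mor_le x k.
Proof.
intros [B [f kf]] tx; apply (kernel_le_iff x kf); now apply trivial_postcomp.
Qed.

Lemma trivial_iff_le_eps (C : category) (Z : subcategory C)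
    (E : mono_coreflector Z) (V X : C) (x : V ~> X) :
  trivial Z x <-> mor_le x (eps E X).
Proof.
split.
- apply trivial_le_normal_mono; exact (eps_normal E X).
- intros [j ->]; apply trivial_comp, trivial_eps.
Qed.

Lemma cokernel_normal_epi (C : category) (Z : subcategory C) (A B Q : C)
    (f : A ~> B) (q : B ~> Q) : is_cokernel Z f q -> normal_epi Z q.
Proof. intros h; now exists A, f. Qed.

Lemma normal_epi_cancel (C : category) (Z : subcategory C) (B Q W : C)
    (q : B ~> Q) (u v : Q ~> W) : normal_epi Z q -> u ∘ q = v ∘ q -> u = v.
Proof.
intros [A [f [tq uq]]] e.
destruct (uq _ (u ∘ q)) as [w [_ Hw]].
{ rewrite <- comp_assoc; now apply trivial_postcomp. }
now rewrite <- (Hw u eq_refl); apply Hw.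
Qed.

Lemma kernel_of_cokernel (C : category) (Z : subcategory C) (K A Q : C)
    (k : K ~> A) (q : A ~> Q) :
  normal_mono Z k -> is_cokernel Z k q -> is_kernel Z q k.
Proof.
intros [B [f [tk uk]]] [tq uq]; split; [exact tq|].
intros V x tx; apply uk.
destruct (uq _ f tk) as [g [-> _]].
rewrite <- comp_assoc; now apply trivial_postcomp.
Qed.

Lemma cokernel_of_kernel (C : category) (Z : subcategory C) (K B Q : C)
    (k : K ~> B) (q : B ~> Q) :
  normal_epi Z q -> is_kernel Z q k -> is_cokernel Z k q.
Proof.
intros [A [f [tq uq]]] kk; split; [exact (proj1 kk)|].
intros Y y ty; apply uq.
exact (trivial_le (proj1 (kernel_le_iff f kk) tq) ty).
Qed.

(** Normal epimorphisms are orthogonal to coreflections: an arrow into an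
    object of [Z] is always trivial, hence always extends along a cokernel. *)
Lemma normal_epi_reflects_trivial (C : category) (Z : subcategory C)
    (E : mono_coreflector Z) (X Y W : C) (e : X ~> Y) (f : Y ~> W) :
  normal_epi Z e -> trivial Z (f ∘ e) -> trivial Z f.
Proof.
intros he; pose proof he as [A [g [_ ug]]].
intros tfe; apply (trivial_iff_le_eps E) in tfe; destruct tfe as [h eh].
destruct (ug _ h) as [h' [eh' _]].
{ exists (incl Z (corefl E W)), (h ∘ g), (idm _); split.
  - exact (proj2_sig (corefl E W)).
  - now rewrite comp_idl. }
apply (trivial_iff_le_eps E); exists h'.
apply (normal_epi_cancel he); now rewrite eh, eh', comp_assoc.
Qed.

Lemma nsub_inv_eps_iff (C : category) (Z : subcategory C)
    (E : mono_coreflector Z) (X Y : C) (f : Y ~> X) (k : nsub Z Y) :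
  is_nsub_inv f (eps_nsub E X) k <-> is_kernel Z f (nsub_mor k).
Proof.
split.
- intros [p [sq univ]]; split.
  { rewrite sq; apply trivial_comp, trivial_eps. }
  intros V x tx; apply (trivial_iff_le_eps E) in tx; destruct tx as [y ey].
  destruct (univ _ x y ey) as [w [[e1 _] _]].
  exists w; split; [now symmetry|].
  intros w' e'; apply (nsub_mono (a := k)); now rewrite e1.
- intros [tk uk].
  destruct (proj1 (trivial_iff_le_eps E _) tk) as [p ep].
  exists p; split; [exact ep|].
  intros V u v e.
  destruct (uk _ u) as [w [ew uw]].
  { rewrite e; apply trivial_comp, trivial_eps. }
  exists w; split.
  + split; [now symmetry|].
    apply (nsub_mono (a := eps_nsub E X)).
    rewrite <- e, ew, comp_assoc, comp_assoc; f_equal; now symmetry.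
  + intros w' [e1 _]; now apply uw.
Qed.

Lemma kernel_exists (C : category) (Z : subcategory C)
    (hC : semi_prenormal Z) (E : mono_coreflector Z) (X Y : C) (f : X ~> Y) :
  exists k : nsub Z X, is_kernel Z f (nsub_mor k).
Proof.
destruct (nsub_inv_exists f (eps_nsub E Y) hC) as [k hk].
exists k; now apply (nsub_inv_eps_iff E).
Qed.

Lemma pullback_le (C : category) (Z : subcategory C) (X Y V : C) (f : Y ~> X)
    (a : nsub Z X) (b : nsub Z Y) (x : V ~> Y) :
  is_nsub_inv f a b ->
  (mor_le (f ∘ x) (nsub_mor a) <-> mor_le x (nsub_mor b)).
Proof.
intros [p [sq univ]]; split.
- intros [y ey]; destruct (univ _ x y ey) as [w [[e _] _]].
  now exists w.
- intros [y ->]; exists (p ∘ y); now rewrite !comp_assoc, sq.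
Qed.

Lemma nsub_inv_swap (C : category) (Z : subcategory C)
    (hC : semi_prenormal Z) (X Y : C) (f : Y ~> X) (a : nsub Z X)
    (b : nsub Z Y) (p : nsub_dom b ~> nsub_dom a) :
  normal_epi Z f -> is_pullback (nsub_mor b) p f (nsub_mor a) ->
  normal_epi Z p.
Proof.
intros hf [sq univ]; apply (spn_stable hC (nsub_normal a) hf (p2 := nsub_mor b)).
split; [now symmetry|].
intros V u v e; destruct (univ _ v u (eq_sym e)) as [w [[e1 e2] uw]].
exists w; split; [now split|].
intros w' [e1' e2']; apply uw; now split.
Qed.

(** The composite of [f] with the cokernel of [a] is a weak cokernel of
    [f^-1 (a)].  Such a [y] first factors through [f], because the kernel of
    [f] lies below every inverse image; the resulting factor trivialises [a]
    because the restriction of [f] to [f^-1 (a)] is again a normal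
    epimorphism, by stability. *)
Lemma cokernel_inverse_image (C : category) (Z : subcategory C)
    (hC : semi_prenormal Z) (E : mono_coreflector Z) (X Y W : C) (f : Y ~> X)
    (a : nsub Z X) (b : nsub Z Y) (y : Y ~> W) :
  normal_epi Z f -> is_nsub_inv f a b -> trivial Z (y ∘ nsub_mor b) ->
  exists g : X ~> W, y = g ∘ f /\ trivial Z (g ∘ nsub_mor a).
Proof.
intros hf hb ty.
destruct (kernel_exists hC E f) as [k hk].
destruct (cokernel_of_kernel hf hk) as [_ uk].
destruct (uk _ y) as [g [eg _]].
{ refine (trivial_le _ ty); apply (pullback_le _ hb).
  apply (trivial_le_normal_mono (Z := Z)); [apply nsub_normal|].
  exact (proj1 hk). }
exists g; split; [exact eg|].
destruct hb as [p pb].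
apply (normal_epi_reflects_trivial E (nsub_inv_swap hC hf pb)).
rewrite <- comp_assoc, <- (proj1 pb), comp_assoc, <- eg; exact ty.
Qed.

(** * Objects with closed coreflection *)

(** Monotonicity and continuity in one statement about arrows, which spares the
    choice of inverse images. *)
Lemma closure_functorial (C : category) (Z : subcategory C)
    (hC : semi_prenormal Z) (c : closure_operator Z) (X Y : C) (f : Y ~> X)
    (a : nsub Z X) (b : nsub Z Y) :
  mor_le (f ∘ nsub_mor b) (nsub_mor a) ->
  mor_le (f ∘ nsub_mor (cl c b)) (nsub_mor (cl c a)).
Proof.
intros le.
destruct (nsub_inv_exists f a hC) as [b' hb'].
destruct (nsub_inv_exists f (cl c a) hC) as [d hd].
apply (pullback_le _ hd).
apply (mor_le_trans (n := nsub_mor (cl c b'))).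
- apply cl_mono; now apply (pullback_le _ hb').
- exact (cl_cont hb' hd).
Qed.

Lemma closed_eps_iff (C : category) (Z : subcategory C)
    (E : mono_coreflector Z) (c : closure_operator Z) (X : C) :
  cl_closed c (eps_nsub E X) <-> trivial Z (nsub_mor (cl c (eps_nsub E X))).
Proof.
split.
- intros [le _]; now apply (trivial_iff_le_eps E).
- intros t; split; [now apply (trivial_iff_le_eps E) in t | apply cl_ext].
Qed.

Lemma dense_iff (C : category) (Z : subcategory C) (c : closure_operator Z)
    (X : C) (a : nsub Z X) :
  cl_dense c a <-> mor_le (idm X) (nsub_mor (cl c a)).
Proof.
split; [now intros [_ le]|].
intros le; split; [|exact le].
exists (nsub_mor (cl c a)); now rewrite comp_idl.
Qed.

Lemma closure_eps_functorial (C : category) (Z : subcategory C)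
    (hC : semi_prenormal Z) (E : mono_coreflector Z) (c : closure_operator Z)
    (X Y : C) (f : X ~> Y) :
  mor_le (f ∘ nsub_mor (cl c (eps_nsub E X))) (nsub_mor (cl c (eps_nsub E Y))).
Proof.
apply (closure_functorial hC), (trivial_iff_le_eps E).
apply trivial_postcomp, trivial_eps.
Qed.

Lemma closed_eps_replete (C : category) (Z : subcategory C)
    (hC : semi_prenormal Z) (E : mono_coreflector Z) (c : closure_operator Z)
    (X Y : C) :
  isomorphic X Y -> cl_closed c (eps_nsub E X) -> cl_closed c (eps_nsub E Y).
Proof.
intros [f [g [_ fg]]]; rewrite !closed_eps_iff; intros t.
rewrite <- (comp_idl (nsub_mor _)), <- fg, <- comp_assoc.
apply trivial_postcomp.
rewrite <- (comp_idl (g ∘ _)).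
refine (trivial_le (closure_eps_functorial hC E c g) _).
now rewrite comp_idl.
Qed.

Definition closed_objects (C : category) (Z : subcategory C)
    (hC : semi_prenormal Z) (E : mono_coreflector Z)
    (c : closure_operator Z) : subcategory C :=
  Subcategory (closed_eps_replete hC (E := E) (c := c)).

Lemma dense_eps_replete (C : category) (Z : subcategory C)
    (hC : semi_prenormal Z) (E : mono_coreflector Z) (c : closure_operator Z)
    (X Y : C) :
  isomorphic X Y -> cl_dense c (eps_nsub E X) -> cl_dense c (eps_nsub E Y).
Proof.
intros [f [g [_ fg]]]; rewrite !dense_iff; intros [j ej].
rewrite <- fg; apply mor_le_precomp.
rewrite <- (comp_idr f), ej, comp_assoc; apply mor_le_precomp.
apply (closure_eps_functorial hC).
Qed.

Definition dense_objects (C : category) (Z : subcategory C)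
    (hC : semi_prenormal Z) (E : mono_coreflector Z)
    (c : closure_operator Z) : subcategory C :=
  Subcategory (dense_eps_replete hC (E := E) (c := c)).

(** * Reflections as universal arrows *)

(** Uniqueness of the factorisation is automatic for a normal epimorphism. *)
Definition normal_reflection (C : category) (Z S : subcategory C) (X Y : C)
    (r : X ~> Y) : Prop :=
  normal_epi Z r /\ S Y /\
  forall (W : C) (f : X ~> W), S W -> exists g : Y ~> W, f = g ∘ r.

Lemma normal_epi_reflective_arrow (C : category) (Z S : subcategory C)
    (X : C) :
  normal_epi_reflective Z S ->
  exists (Y : C) (r : X ~> Y), normal_reflection Z S r.
Proof.
intros [L [adj he]].
exists (incl S (L X)), (unit_adj adj X); split; [apply he|].
split; [exact (proj2_sig (L X))|].
intros W f SW; pose (W' := exist _ W SW : full S).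
exists ((counit_adj adj W' : incl S (L W) ~> W) ∘ fmap (incl S) (fmap L f)).
rewrite <- comp_assoc, (unit_natural adj f), comp_assoc.
pose proof (triangle_right adj W') as t; cbn in t |- *.
now rewrite t, comp_idl.
Qed.

Lemma normal_epi_reflective_intro (C : category) (Z S : subcategory C) :
  (forall X : C, exists (Y : C) (r : X ~> Y), normal_reflection Z S r) ->
  normal_epi_reflective Z S.
Proof.
intros h.
assert (h' : forall X : C, exists p : {Y : full S & X ~> incl S Y},
    normal_reflection Z S (projT2 p)).
{ intros X; destruct (h X) as [Y [r hr]].
  now exists (existT _ (exist _ Y (proj1 (proj2 hr)) : full S) r). }
pose (R X := projT1 (proj1_sig (constructive_indefinite_description _ (h' X)))).
pose (r X := projT2 (proj1_sig (constructive_indefinite_description _ (h' X)))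
  : X ~> incl S (R X)).
assert (hr : forall X, normal_reflection Z S (r X)).
{ intros X; exact (proj2_sig (constructive_indefinite_description _ (h' X))). }
assert (ext : forall (X : C) (W : full S) (f : X ~> incl S W),
    {g : incl S (R X) ~> incl S W | f = g ∘ r X}).
{ intros X W f; apply constructive_indefinite_description.
  apply (hr X), (proj2_sig W). }
assert (cancel : forall (X W : C) (u v : incl S (R X) ~> W),
    u ∘ r X = v ∘ r X -> u = v).
{ intros X W u v; exact (normal_epi_cancel (proj1 (hr X))). }
pose (Rm (X Y : C) (f : X ~> Y) := proj1_sig (ext X (R Y) (r Y ∘ f))).
assert (Rm_nat : forall (X Y : C) (f : X ~> Y), r Y ∘ f = Rm X Y f ∘ r X).
{ intros X Y f; exact (proj2_sig (ext X (R Y) (r Y ∘ f))). }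
assert (Rm_id : forall X, Rm X X (idm X) = idm _).
{ intros X; apply cancel; now rewrite <- Rm_nat, comp_idl, comp_idr. }
assert (Rm_comp : forall (X Y W : C) (g : Y ~> W) (f : X ~> Y),
    Rm X W (g ∘ f) = Rm Y W g ∘ Rm X Y f).
{ intros X Y W g f; apply cancel.
  now rewrite <- Rm_nat, <- comp_assoc, <- Rm_nat, !comp_assoc, <- Rm_nat. }
pose (L := @Functor C (full S) R Rm Rm_id Rm_comp).
pose (co (A : full S) := proj1_sig (ext _ A (idm (incl S A)))).
assert (hco : forall A : full S, idm _ = co A ∘ r (incl S A)).
{ intros A; exact (proj2_sig (ext _ A (idm (incl S A)))). }
assert (tl : forall X, co (R X) ∘ Rm _ _ (r X) = idm (incl S (R X))).
{ intros X; apply cancel.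
  now rewrite <- comp_assoc, <- Rm_nat, comp_assoc, <- hco, !comp_idl. }
unshelve eset (adj := @Adjunction C (full S) L (incl S) r co _ _ tl _).
- intros X Y f; exact (eq_sym (Rm_nat X Y f)).
- intros A B f; apply (cancel (incl S A)).
  change (((f : incl S A ~> incl S B) ∘ co A) ∘ r (incl S A)
    = (co B ∘ Rm (incl S A) (incl S B) f) ∘ r (incl S A)).
  rewrite <- !comp_assoc, <- Rm_nat, <- hco, comp_idr.
  now rewrite comp_assoc, <- hco, comp_idl.
- intros A; exact (eq_sym (hco A)).
- exists L, adj; intros X; exact (proj1 (hr X)).
Qed.

Lemma torsion_free_reflective (C : category) (Z F : subcategory C) :
  torsion_free Z F -> normal_epi_reflective Z F.
Proof.
intros [T [hTF hex]]; apply normal_epi_reflective_intro; intros X.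
destruct (hex X) as [A [B [f [g [TA [FB [kf cg]]]]]]].
exists B, g; split; [exact (cokernel_normal_epi cg)|].
split; [exact FB|].
intros W y FW; destruct (proj2 cg _ y (hTF _ _ _ TA FW)) as [y' [e _]].
now exists y'.
Qed.

(** * The closure operator determined by a subcategory *)

Definition annihilated (C : category) (Z F : subcategory C) (A X V : C)
    (a : A ~> X) (x : V ~> X) : Prop :=
  forall (Y : C) (f : X ~> Y), F Y -> trivial Z (f ∘ a) -> trivial Z (f ∘ x).

Definition regular_closure (C : category) (Z : subcategory C)
    (c : closure_operator Z) (F : subcategory C) : Prop :=
  forall (X : C) (a : nsub Z X) (V : C) (x : V ~> X),
    mor_le x (nsub_mor (cl c a)) <-> annihilated Z F (nsub_mor a) x.

Lemma regular_closure_sub_eq (C : category) (Z : subcategory C)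
    (c : closure_operator Z) (F F' : subcategory C) :
  sub_eq F F' -> regular_closure c F -> regular_closure c F'.
Proof.
intros e h X a V x; rewrite (h X a V x); unfold annihilated.
split; intros H Y f FY; apply H; now apply e.
Qed.

Lemma regular_closure_unique (C : category) (Z : subcategory C)
    (c c' : closure_operator Z) (F : subcategory C) :
  regular_closure c F -> regular_closure c' F -> cl_iso c c'.
Proof.
intros h h' X a; split.
- apply h', h, mor_le_refl.
- apply h, h', mor_le_refl.
Qed.

(** The cokernel of [a] followed by a reflection is universal among the arrows
    into [F] that trivialise [a], so it alone decides what is annihilated. *)
Lemma annihilated_iff (C : category) (Z F : subcategory C) (A X Q R V : C)
    (a : A ~> X) (q : X ~> Q) (r : Q ~> R) (x : V ~> X) :
  is_cokernel Z a q -> normal_reflection Z F r ->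
  (annihilated Z F a x <-> trivial Z (r ∘ q ∘ x)).
Proof.
intros [tq uq] [_ [FR ur]]; split.
- intros h; apply h; [exact FR|].
  rewrite <- comp_assoc; now apply trivial_postcomp.
- intros t Y f FY tf.
  destruct (uq _ f tf) as [g [-> _]], (ur _ g FY) as [g' ->].
  rewrite <- !comp_assoc; apply trivial_postcomp; now rewrite comp_assoc.
Qed.

Lemma regular_closure_exists (C : category) (Z : subcategory C)
    (hC : semi_prenormal Z) (E : mono_coreflector Z) (F : subcategory C) :
  normal_epi_reflective Z F ->
  exists c : closure_operator Z, regular_closure c F.
Proof.
intros hF.
assert (ex : forall (X : C) (a : nsub Z X), exists b : nsub Z X,
    forall (V : C) (x : V ~> X),
    mor_le x (nsub_mor b) <-> annihilated Z F (nsub_mor a) x).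
{ intros X a.
  destruct (spn_cokernel hC (nsub_normal a)) as [Q [q hq]].
  destruct (normal_epi_reflective_arrow Q hF) as [R [r hr]].
  destruct (kernel_exists hC E (r ∘ q)) as [b hb].
  exists b; intros V x.
  now rewrite (annihilated_iff x hq hr), (kernel_le_iff x hb). }
pose (c X a := proj1_sig (constructive_indefinite_description _ (ex X a))).
assert (hc : forall (X : C) (a : nsub Z X) (V : C) (x : V ~> X),
    mor_le x (nsub_mor (c X a)) <-> annihilated Z F (nsub_mor a) x).
{ intros X a.
  exact (proj2_sig (constructive_indefinite_description _ (ex X a))). }
assert (self : forall X a, annihilated Z F (nsub_mor a) (nsub_mor (c X a))).
{ intros X a; apply hc, mor_le_refl. }
unshelve eexists (@ClosureOperator C Z c _ _ _); [| | | exact hc].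
- intros X a; apply hc; now intros Y f _ t.
- intros X a b le; apply hc; intros Y f FY t.
  apply (self X a); [exact FY | exact (trivial_le le t)].
- intros X Y f a b d hb hd; apply (pullback_le _ hd), hc.
  intros W g FW t; rewrite comp_assoc; apply (self Y b); [exact FW|].
  rewrite <- comp_assoc; refine (trivial_le _ t).
  apply (pullback_le _ hb), mor_le_refl.
Qed.

Lemma regular_closure_normal (C : category) (Z : subcategory C)
    (hC : semi_prenormal Z) (E : mono_coreflector Z) (c : closure_operator Z)
    (F : subcategory C) :
  regular_closure c F -> normal_closure_operator c.
Proof.
intros h.
assert (self : forall X a, annihilated Z F (nsub_mor a) (nsub_mor (@cl _ _ c X a))).
{ intros X a; apply h, mor_le_refl. }
split.
- intros X a; split; [|apply cl_ext].
  apply h; intros Y f FY t; apply (self X (cl c a)); [exact FY|].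
  now apply (self X a).
- intros X Y f a b d hf hb hd; split; [exact (cl_cont hb hd)|].
  apply h; intros W y FW ty.
  destruct (cokernel_inverse_image hC E hf hb ty) as [g [-> tg]].
  rewrite <- comp_assoc.
  refine (trivial_le _ (self X a _ g FW tg)).
  apply (pullback_le _ hd), mor_le_refl.
Qed.

(** If [eps_X] is closed, then the reflection of [X] has a trivial kernel, so
    that the identity of [X] factors through it. *)
Lemma sub_eq_closed_objects (C : category) (Z : subcategory C)
    (hC : semi_prenormal Z) (E : mono_coreflector Z) (c : closure_operator Z)
    (F : subcategory C) :
  normal_epi_reflective Z F -> regular_closure c F ->
  sub_eq (closed_objects hC E c) F.
Proof.
intros hF h X; unfold closed_objects; cbn; rewrite closed_eps_iff; split.
- intros t.
  destruct (normal_epi_reflective_arrow X hF) as [R [r [er [FR ur]]]].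
  destruct (kernel_exists hC E r) as [k hk].
  destruct (proj2 (cokernel_of_kernel er hk) _ (idm X)) as [s [es _]].
  { refine (trivial_le (k := nsub_mor (cl c (eps_nsub E X))) _ _).
    - apply h; intros Y f FY _; destruct (ur _ f FY) as [g ->].
      rewrite <- comp_assoc; apply trivial_postcomp, (proj1 hk).
    - now rewrite comp_idl. }
  refine (replete_sub _ FR); exists s, r; split; [|now symmetry].
  apply (normal_epi_cancel er).
  now rewrite <- comp_assoc, <- es, comp_idl, comp_idr.
- intros FX; rewrite <- comp_idl.
  assert (self : annihilated Z F (eps E X) (nsub_mor (cl c (eps_nsub E X)))).
  { apply (h X (eps_nsub E X)), mor_le_refl. }
  apply self; [exact FX|].
  apply trivial_postcomp, trivial_eps.
Qed.

(** * The reflection determined by a normal closure operator *)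

(** The reflection quotient [q] pulls [eps_Q] back to its kernel
    [c(eps_X)], which is closed; by normality [c(eps_Q)] is pulled back to the
    same arrow, and what becomes trivial after restriction along a normal
    epimorphism was trivial. *)
Lemma cokernel_closure_eps_closed (C : category) (Z : subcategory C)
    (hC : semi_prenormal Z) (E : mono_coreflector Z) (c : closure_operator Z)
    (X Q : C) (q : X ~> Q) :
  normal_closure_operator c ->
  is_cokernel Z (nsub_mor (cl c (eps_nsub E X))) q ->
  cl_closed c (eps_nsub E Q).
Proof.
intros [idem norm] hq; apply closed_eps_iff.
set (k := cl c (eps_nsub E X)) in *.
pose proof (kernel_of_cokernel (nsub_normal k) hq) as hk.
pose proof (cokernel_normal_epi hq) as eq.
destruct (nsub_inv_exists q (cl c (eps_nsub E Q)) hC) as [d hd].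
destruct (norm _ _ _ _ _ _ eq (proj2 (nsub_inv_eps_iff E q k) hk) hd)
  as [_ le].
pose proof hd as [p pb].
apply (normal_epi_reflects_trivial E (nsub_inv_swap hC eq pb)).
rewrite <- (proj1 pb).
refine (trivial_le _ (proj1 hk)).
refine (mor_le_trans le _); apply idem.
Qed.

Lemma closure_trivial_into_closed (C : category) (Z : subcategory C)
    (hC : semi_prenormal Z) (E : mono_coreflector Z) (c : closure_operator Z)
    (X Y : C) (f : X ~> Y) (a : nsub Z X) :
  cl_closed c (eps_nsub E Y) -> trivial Z (f ∘ nsub_mor a) ->
  trivial Z (f ∘ nsub_mor (cl c a)).
Proof.
intros [le _] t; apply (trivial_iff_le_eps E).
refine (mor_le_trans _ le); apply (closure_functorial hC).
now apply (trivial_iff_le_eps E) in t.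
Qed.

Lemma cokernel_closure_eps_reflection (C : category) (Z : subcategory C)
    (hC : semi_prenormal Z) (E : mono_coreflector Z) (c : closure_operator Z)
    (X Q : C) (q : X ~> Q) :
  normal_closure_operator c ->
  is_cokernel Z (nsub_mor (cl c (eps_nsub E X))) q ->
  normal_reflection Z (closed_objects hC E c) q.
Proof.
intros hc hq; split; [exact (cokernel_normal_epi hq)|].
split; [exact (cokernel_closure_eps_closed hC hc hq)|].
intros W f FW; destruct (proj2 hq _ f) as [g [e _]]; [|now exists g].
apply (closure_trivial_into_closed hC FW), trivial_postcomp, trivial_eps.
Qed.

Lemma closed_objects_reflective (C : category) (Z : subcategory C)
    (hC : semi_prenormal Z) (E : mono_coreflector Z) (c : closure_operator Z) :
  normal_closure_operator c ->
  normal_epi_reflective Z (closed_objects hC E c).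
Proof.
intros hc; apply normal_epi_reflective_intro; intros X.
destruct (spn_cokernel hC (nsub_normal (cl c (eps_nsub E X)))) as [Q [q hq]].
exists Q, q; now apply cokernel_closure_eps_reflection.
Qed.

Lemma normal_closure_regular (C : category) (Z : subcategory C)
    (hC : semi_prenormal Z) (E : mono_coreflector Z) (c : closure_operator Z) :
  normal_closure_operator c -> regular_closure c (closed_objects hC E c).
Proof.
intros hc X a V x; split.
- intros le Y f FY t.
  exact (trivial_le le (closure_trivial_into_closed hC FY t)).
- destruct (spn_cokernel hC (nsub_normal a)) as [Q [q hq]].
  set (k := cl c (eps_nsub E Q)).
  destruct (spn_cokernel hC (nsub_normal k)) as [R [r hr]].
  pose proof (cokernel_closure_eps_reflection hC hc hr) as rr.
  rewrite (annihilated_iff x hq rr), <- comp_assoc.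
  rewrite (kernel_le_iff _ (kernel_of_cokernel (nsub_normal k) hr)).
  intros le; destruct (nsub_inv_exists q k hC) as [d hd].
  apply (pullback_le _ hd) in le; refine (mor_le_trans le _).
  (* [a] is the kernel of [q], that is, the inverse image of [eps_Q]. *)
  pose proof (kernel_of_cokernel (nsub_normal a) hq) as ha.
  apply (proj2 hc _ _ q (eps_nsub E Q) a d); [|now apply nsub_inv_eps_iff|exact hd].
  exact (cokernel_normal_epi hq).
Qed.

Lemma closed_objects_iso (C : category) (Z : subcategory C)
    (hC : semi_prenormal Z) (E : mono_coreflector Z)
    (c c' : closure_operator Z) :
  cl_iso c c' -> sub_eq (closed_objects hC E c) (closed_objects hC E c').
Proof.
intros h X; destruct (h X (eps_nsub E X)) as [le le'].
split; intros [l _]; (split; [|apply cl_ext]).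
- exact (mor_le_trans le' l).
- exact (mor_le_trans le l).
Qed.

(** * Torsion theories and weak heredity *)

Lemma dense_eps_iff (C : category) (Z : subcategory C)
    (E : mono_coreflector Z) (c : closure_operator Z) (F : subcategory C)
    (X : C) :
  regular_closure c F ->
  (cl_dense c (eps_nsub E X) <->
   forall (Y : C) (f : X ~> Y), F Y -> trivial Z f).
Proof.
intros h; rewrite dense_iff, (h _ _ _ _); split.
- intros H Y f FY; rewrite <- comp_idr.
  apply H; [exact FY | apply trivial_postcomp, trivial_eps].
- intros H Y f FY _; apply trivial_comp; now apply H.
Qed.

Lemma torsion_iff (C : category) (Z T F : subcategory C) (X : C) :
  is_torsion_theory Z T F ->
  (T X <-> forall (Y : C) (f : X ~> Y), F Y -> trivial Z f).
Proof.
intros [hTF hex]; split; [intros TX Y f FY; now apply hTF|].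
intros H; destruct (hex X) as [A [B [f [g [TA [FB [kf _]]]]]]].
(* The torsion part of [X] is a monomorphism which is also a retraction. *)
destruct (proj1 (kernel_le_iff (idm X) kf)) as [s es].
{ apply trivial_comp; now apply H. }
refine (replete_sub _ TA); exists f, s; split; [|now symmetry].
apply (kernel_mono kf); now rewrite comp_assoc, <- es, comp_idl, comp_idr.
Qed.

(** Weak heredity makes dense the arrow [j] by which [eps_X] factors through
    [c(eps_X)].  Since [j] starts from an object of [Z], it is trivial, hence
    lies below the coreflection of the domain of [c(eps_X)]. *)
Lemma weakly_hereditary_dense_eps (C : category) (Z : subcategory C)
    (E : mono_coreflector Z) (c : closure_operator Z) (X : C) :
  weakly_hereditary c ->
  cl_dense c (eps_nsub E (nsub_dom (cl c (eps_nsub E X)))).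
Proof.
intros wh; destruct (cl_ext c (eps_nsub E X)) as [j ej].
pose proof (wh X (eps_nsub E X) j (eq_sym ej)) as d.
apply dense_iff in d; apply dense_iff.
refine (mor_le_trans d (cl_mono c _)); cbn.
apply trivial_iff_le_eps.
exists (incl Z (corefl E X)), (idm _), j; split.
- exact (proj2_sig (corefl E X)).
- now rewrite comp_idr.
Qed.

Lemma closure_torsion_theory (C : category) (Z : subcategory C)
    (hC : semi_prenormal Z) (E : mono_coreflector Z) (c : closure_operator Z) :
  normal_closure_operator c -> weakly_hereditary c ->
  is_torsion_theory Z (dense_objects hC E c) (closed_objects hC E c).
Proof.
intros hc wh; split.
- intros A B f TA FB.
  exact (proj1 (dense_eps_iff E A (normal_closure_regular hC E hc)) TA B f FB).
- intros X; set (k := cl c (eps_nsub E X)).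
  destruct (spn_cokernel hC (nsub_normal k)) as [Q [q hq]].
  exists (nsub_dom k), Q, (nsub_mor k), q; split; [|split; [|split]].
  + now apply weakly_hereditary_dense_eps.
  + exact (cokernel_closure_eps_closed hC hc hq).
  + exact (kernel_of_cokernel (nsub_normal k) hq).
  + exact hq.
Qed.

(** An arrow [f] into [F] that trivialises [j] extends along [p], the
    restriction of the cokernel [q] to [c(a)], because the kernel of [p] lies
    below [j]; the extension starts from a torsion object, so it is trivial. *)
Lemma torsion_free_weakly_hereditary (C : category) (Z : subcategory C)
    (hC : semi_prenormal Z) (E : mono_coreflector Z) (c : closure_operator Z)
    (F : subcategory C) :
  torsion_free Z F -> regular_closure c F -> weakly_hereditary c.
Proof.
intros [T [hTF hex]] h X a j e; apply dense_iff, h; cbn.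
intros Y f FY tf; apply trivial_comp.
destruct (spn_cokernel hC (nsub_normal a)) as [Q [q hq]].
destruct (hex Q) as [A [R [t [r [TA [FR [kt cr]]]]]]].
pose (t' := NSub (ex_intro _ R (ex_intro _ r kt)) : nsub Z Q).
assert (rr : normal_reflection Z F r).
{ split; [exact (cokernel_normal_epi cr)|]; split; [exact FR|].
  intros W y FW; destruct (proj2 cr _ y (hTF _ _ _ TA FW)) as [y' [ey _]].
  now exists y'. }
assert (spec : forall (V : C) (x : V ~> X),
    mor_le x (nsub_mor (cl c a)) <-> mor_le (q ∘ x) t).
{ intros V x; rewrite (h _ _ _ _), (annihilated_iff x hq rr), <- comp_assoc.
  exact (kernel_le_iff _ kt). }
(* Hence [c(a)] is the inverse image of the torsion part [t] along [q]. *)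
destruct (proj1 (spec _ _) (mor_le_refl (nsub_mor (cl c a)))) as [p ep].
assert (pb : is_pullback (nsub_mor (cl c a)) p q (nsub_mor t')).
{ split; [exact ep|].
  intros V u v euv.
  destruct (proj2 (spec _ u)) as [w ew]; [now exists v|].
  exists w; split.
  - split; [now symmetry|].
    apply (kernel_mono kt); rewrite comp_assoc, <- ep, <- comp_assoc, <- ew.
    exact euv.
  - intros w' [e1 _]; apply (nsub_mono (a := cl c a)); now rewrite e1. }
pose proof (nsub_inv_swap (a := t') hC (cokernel_normal_epi hq) pb) as he.
destruct (kernel_exists hC E p) as [k hk].
destruct (proj2 (cokernel_of_kernel he hk) _ f) as [g [-> _]].
- refine (trivial_le _ tf).
  assert (le : mor_le (nsub_mor (cl c a) ∘ nsub_mor k) (nsub_mor a)).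
  { apply (kernel_le_iff _ (kernel_of_cokernel (nsub_normal a) hq)).
    rewrite comp_assoc, ep, <- comp_assoc; apply trivial_postcomp, (proj1 hk). }
  destruct le as [i ei]; exists i; apply (nsub_mono (a := cl c a)).
  now rewrite ei, comp_assoc, e.
- apply trivial_comp; now apply hTF.
Qed.

(** * The correspondence *)

Theorem proposition4p5 (C : category) (Z : subcategory C)
    (hC : semi_prenormal Z) (hZ : reflective Z) (E : mono_coreflector Z) :
  exists Phi : closure_operator Z -> subcategory C,
    bijective_correspondence (@cl_iso C Z) (@sub_eq C)
      (@normal_closure_operator C Z) (normal_epi_reflective Z) Phi /\
    bijective_correspondence (@cl_iso C Z) (@sub_eq C)
      (fun c => normal_closure_operator c /\ weakly_hereditary c)
      (torsion_free Z) Phi /\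
    (forall (c : closure_operator Z) (T F : subcategory C),
       normal_closure_operator c -> weakly_hereditary c ->
       is_torsion_theory Z T F -> sub_eq F (Phi c) ->
       (forall X : C, T X <-> cl_dense c (eps_nsub E X)) /\
       (forall X : C, F X <-> cl_closed c (eps_nsub E X))).
Proof.
exists (closed_objects hC E).
assert (inj : forall c c', normal_closure_operator c ->
    normal_closure_operator c' ->
    (cl_iso c c' <-> sub_eq (closed_objects hC E c) (closed_objects hC E c'))).
{ intros c c' hc hc'; split; [apply closed_objects_iso|].
  intros e; apply (regular_closure_unique (F := closed_objects hC E c')).
  - exact (regular_closure_sub_eq e (normal_closure_regular hC E hc)).
  - exact (normal_closure_regular hC E hc'). }
split; [|split].
- split; [|split; [exact inj|]].
  + intros c; apply closed_objects_reflective.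
  + intros F hF; destruct (regular_closure_exists hC E hF) as [c h].
    exists c; split; [exact (regular_closure_normal hC E h)|].
    exact (sub_eq_closed_objects hC E hF h).
- split; [|split].
  + intros c [hc wh]; exists (dense_objects hC E c).
    now apply closure_torsion_theory.
  + intros c c' [hc _] [hc' _]; now apply inj.
  + intros F tF; pose proof (torsion_free_reflective tF) as hF.
    destruct (regular_closure_exists hC E hF) as [c h].
    exists c; split; [split|].
    * exact (regular_closure_normal hC E h).
    * exact (torsion_free_weakly_hereditary hC E tF h).
    * exact (sub_eq_closed_objects hC E hF h).
- intros c T F hc wh tt e; split; [|exact e].
  assert (h : regular_closure c F).
  { refine (regular_closure_sub_eq _ (normal_closure_regular hC E hc)).
    intros X; symmetry; apply e. }
  intros X; rewrite (torsion_iff X tt); symmetry; exact (dense_eps_iff E X h).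
Qed.
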